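(* For every positive integer $n$ there exists a finite simple connected graph $G$ such that $\mathrm{reg}(R/I(G))-\mathrm{v}(I(G))=n$, where $R=K[V(G)]$.
   Context: $K$ is a field; $R=K[V(G)]$ is the polynomial ring whose variables are the vertices of $G$, with the standard grading, and $R_d$ is its degree-$d$ component. The edge ideal $I(G)\subset R$ is generated by the monomials $xy$ with $\{x,y\}\in E(G)$. For a proper graded ideal $I$ of $R$, its v-number is $\mathrm{v}(I)=\min\{d\ge 0 : \exists f\in R_d \text{ and } \mathfrak{p}\in\mathrm{Ass}(R/I)\text{ with } (I:f)=\mathfrak{p}\}$. $\mathrm{reg}(R/I)$ is the Castelnuovo-Mumford regularity, $\max\{j-i:\beta_{i,j}(R/I)\ne0\}$. *)

(* Defs.v *)
From HB Require Import structures.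
From mathcomp Require Import all_boot all_order all_algebra.
From mathcomp Require Import mpoly.

Set Implicit Arguments.
Unset Strict Implicit.
Unset Printing Implicit Defensive.

Import GRing.Theory.
Local Open Scope ring_scope.

Record sgraph := SGraph {
  vertex :> finType;
  adj : rel vertex;
  adj_sym : ssrbool.symmetric adj;
  adj_irr : irreflexive adj }.

Definition connected_graph (G : sgraph) : Prop :=
  (0 < #|G|)%N /\ forall x y : G, connect (@adj G) x y.

Section Ideals.
Variables (K : fieldType) (n : nat).
Notation R := {mpoly K[n]}.

Definition is_ideal (I : R -> Prop) : Prop :=
  [/\ I 0, (forall f g, I f -> I g -> I (f + g))
    & forall f g, I g -> I (f * g)].

Definition ideal_gen (S : R -> Prop) (f : R) : Prop :=
  exists (m : nat) (c g : 'I_m -> R),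
    (forall i, S (g i)) /\ f = \sum_(i < m) c i * g i.

Definition prime_ideal (P : R -> Prop) : Prop :=
  [/\ is_ideal P, ~ P 1 & forall f g, P (f * g) -> P f \/ P g].

Definition colon (I : R -> Prop) (f : R) : R -> Prop := fun h => I (h * f).

(* [colon I g] is the annihilator of the class of [g] in R/I. *)
Definition associated_prime (I P : R -> Prop) : Prop :=
  prime_ideal P /\ exists g : R, forall h, P h <-> colon I g h.

Definition v_witness (I : R -> Prop) (d : nat) : Prop :=
  exists (f : R) (P : R -> Prop),
    [/\ f \is d.-homog, associated_prime I P & forall h, colon I f h <-> P h].

Definition is_v_number (I : R -> Prop) (v : nat) : Prop :=
  v_witness I v /\ forall d, v_witness I d -> (v <= d)%N.

(* The graded component R_d for d in Z, zero for d < 0. *)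
Definition in_degree (d : int) (f : R) : Prop :=
  match d with
  | Posz e => f \is e.-homog
  | Negz _ => f = 0
  end.

(* Minimal graded free resolution of R/I
     ... -> F_2 -> F_1 -> F_0 -> R/I -> 0,
   where F_i is free with basis indexed by 'I_(rk i), the k-th basis element
   having degree [shift i k].  Elements of F_i are row vectors, on which the
   differential F_(i+1) -> F_i acts as right multiplication by [diff i].  The
   map F_0 -> R/I is right multiplication by [aug] followed by R -> R/I.
   [diff_min] says that the image of F_(i+1) lies in mF_i, where m is the ideal
   of the polynomials without constant term. *)
Record min_resolution (I : R -> Prop) := MinResolution {
  rk : nat -> nat;
  shift : forall i, 'I_(rk i) -> int;
  aug : 'cV[R]_(rk 0);
  diff : forall i, 'M[R]_(rk i.+1, rk i);
  aug_homog : forall k, in_degree (shift k) (aug k 0);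
  diff_homog : forall i k l, in_degree (shift k - shift l) (diff i k l);
  aug_surj : forall f : R, exists w : 'rV[R]_(rk 0), I (f - (w *m aug) 0 0);
  exact0 : forall w : 'rV[R]_(rk 0),
    I ((w *m aug) 0 0) <-> exists u, w = u *m diff 0;
  exactS : forall i (w : 'rV[R]_(rk i.+1)),
    w *m diff i = 0 <-> exists u, w = u *m diff i.+1;
  diff_min : forall i k l, (diff i k l)@_0%MM = 0 }.

Definition betti (I : R -> Prop) (F : min_resolution I) (i : nat) (j : int) :
  nat := #|[set k : 'I_(rk F i) | shift k == j]|.

(* Any two minimal graded free resolutions of R/I are isomorphic, so the graded
   Betti numbers, and hence [r], do not depend on the choice of [F]. *)
Definition is_regularity (I : R -> Prop) (r : int) : Prop :=
  exists F : min_resolution I,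
    (exists i j, betti F i j <> 0%N /\ j - i%:Z = r) /\
    (forall i j, betti F i j <> 0%N -> j - i%:Z <= r).

End Ideals.

Definition var (K : fieldType) (G : sgraph) (x : G) : {mpoly K[#|G|]} :=
  'X_(enum_rank x).

Definition edge_ideal (K : fieldType) (G : sgraph) : {mpoly K[#|G|]} -> Prop :=
  ideal_gen (fun f => exists x y : G, adj x y /\ f = var K x * var K y).
Arguments edge_ideal K G f : clear implicits.

(* Main.v *)
Require Import Defs.
From mathcomp Require Import all_boot all_order all_algebra.
From mathcomp Require Import mpoly.
From mathcomp Require Import zify ring.

Set Implicit Arguments.
Unset Strict Implicit.
Unset Printing Implicit Defensive.

Import GRing.Theory.
Local Open Scope ring_scope.

(** The graph is a spider: a center [x], joints [y_0, ..., y_n] adjacent to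
    [x], and feet [z_0, ..., z_n] with [z_l] adjacent to [y_l].  Its edge ideal
    has v-number 1 and regularity [n + 1].

    v-number.  The neighbours of the center meet every edge, so
    [(I : x) = (y_0, ..., y_n)], a prime ideal, and [x] witnesses the value 1
    ([colon_center], [prime_seq_ideal_var]).  A witness of degree 0 would be a
    nonzero constant, so [I] itself would be prime, although it contains
    [y_0 x] but neither factor.

    Regularity.  Write [I = J + x Q] with [J = (y_l z_l)] contained in
    [Q = (y_l)].  Both ideals are generated by regular sequences, hence are
    resolved by Koszul complexes [A] and [B], and sending the basis vector
    [e_S] to [z_S e_S] gives a chain map [A -> B] over [R/J -> R/Q].  Since [x]
    is regular modulo [J], multiplication by [x] yields an exact sequence
    [0 -> (Q/J)(-1) -> R/J -> R/I -> 0].  The cone of the truncations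
    [A_{>=1} -> B_{>=1}] resolves [Q/J], and the cone of the map from it to [A]
    resolves [R/I].  Its module in homological degree [i + 1] is
    [A_{i+1} + B_{i+1}(-1) + A_i(-1)] (the last summand only for [i > 0]), where
    [A_i] lives in degree [2 i] and [B_i] in degree [i].  All entries of its
    differentials vanish or have positive degree, so it is minimal, and the
    largest difference between internal and homological degree is [n + 1],
    reached by the top module of [A] ([glue_exact], [glue_graded],
    [glue_regularity]).

    Everything rests on one criterion for the exactness of a mapping cone,
    [cone_exact], used for each Koszul step and for both cones above. *)

(** * Mapping cones of complexes of free modules *)

Section Complexes.
Variable R : comNzRingType.

Definition row_image p q (d : 'M[R]_(p, q)) (w : 'rV[R]_q) :=
  exists u, w = u *m d.

Lemma row_image_col_mx p1 p2 q (d : 'M[R]_(p1, q)) (e : 'M[R]_(p2, q)) w :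
  row_image (col_mx d e) w <-> exists a b, w = a *m d + b *m e.
Proof.
split=> [[u ->]|[a [b ->]]].
  exists (lsubmx u), (rsubmx u).
  by rewrite -[in LHS](hsubmxK u) mul_row_col.
by exists (row_mx a b); rewrite mul_row_col.
Qed.

Definition is_complex (r : nat -> nat) (d : forall i, 'M[R]_(r i.+1, r i)) :=
  forall i, d i.+1 *m d i = 0.

Definition exact (r : nat -> nat) (d : forall i, 'M[R]_(r i.+1, r i)) :=
  forall i w, w *m d i = 0 -> row_image (d i.+1) w.

Section Cone.
Variables (rF rG : nat -> nat).
Variables (dF : forall i, 'M[R]_(rF i.+1, rF i)).
Variables (dG : forall i, 'M[R]_(rG i.+1, rG i)).
Variable phi : forall i, 'M[R]_(rG i, rF i).

(** Conventions: elements are row vectors and maps act on the right.  The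
    map [phi] is a family of comparison matrices from [dG] to [dF]; the sign of
    the cone is carried by [dG]. *)
Definition cone_rank i := if i is j.+1 then (rF j.+1 + rG j)%N else rF 0.

Definition cone_diff i : 'M[R]_(cone_rank i.+1, cone_rank i) :=
  match i with
  | 0 => col_mx (dF 0) (phi 0)
  | j.+1 => block_mx (dF j.+1) 0 (phi j.+1) (- dG j)
  end.

Hypothesis phi_chain : forall i, dG i *m phi i = phi i.+1 *m dF i.

Lemma cone_is_complex :
  is_complex dF -> is_complex dG -> is_complex cone_diff.
Proof.
move=> cF cG [|i] /=.
  rewrite mul_block_col cF mul0mx addr0 mulNmx phi_chain subrr.
  exact: col_mx0.
rewrite mulmx_block !cF !mul0mx !mulmx0 !addr0 mulNmx phi_chain subrr add0r.
by rewrite mulNmx mulmxN opprK cG; exact: block_mx0.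
Qed.

(** In the long exact sequence of the cone, the only homology that could
    survive in positive degree is the kernel of [H_0(G) -> H_0(F)]; the last
    hypothesis says that this map is injective. *)
Lemma cone_exact :
    exact dF -> exact dG ->
    (forall b, row_image (dF 0) (b *m phi 0) -> row_image (dG 0) b) ->
  exact cone_diff.
Proof.
move=> eF eG inj [|i] /= w; rewrite -(hsubmxK w);
  set a := lsubmx w; set b := rsubmx w.
  rewrite mul_row_col => ab0.
  have [c bE] : row_image (dG 0) b.
    apply: inj; exists (- a); apply/eqP.
    by rewrite mulNmx -addr_eq0 addrC ab0.
  have [e aE] : row_image (dF 1) (a + c *m phi 1).
    by apply: eF; rewrite mulmxDl -mulmxA -phi_chain mulmxA -bE.
  exists (row_mx e (- c)).
  by rewrite mul_row_block mulmx0 add0r !mulNmx mulmxN opprK -bE -aE addrK.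
rewrite mul_row_block mulmx0 add0r mulmxN -row_mx0 => /eq_row_mx [ab0 /eqP].
rewrite oppr_eq0 => /eqP /eG [c bE].
have [e aE] : row_image (dF i.+2) (a + c *m phi i.+2).
  by apply: eF; rewrite mulmxDl -mulmxA -phi_chain mulmxA -bE.
exists (row_mx e (- c)).
by rewrite mul_row_block mulmx0 add0r !mulNmx mulmxN opprK -bE -aE addrK.
Qed.

End Cone.

(** * Koszul complexes *)

(** Adjoining one element to the sequence takes the cone of multiplication by
    it on the previous complex.  The ranks are kept apart from the sequence so
    that complexes of different sequences share their modules. *)
Fixpoint koszul_rank k : nat -> nat :=
  if k is l.+1 then cone_rank (koszul_rank l) (koszul_rank l)
  else fun i => (i == 0%N : nat).

Fixpoint koszul (f : nat -> R) k :
    forall i, 'M[R]_(koszul_rank k i.+1, koszul_rank k i) :=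
  if k is l.+1 then cone_diff (koszul f l) (koszul f l) (fun i => (f l)%:M)
  else fun i => 0.

(** The ideal of the first [k] terms, grown one generator at a time in step
    with the cones that build [koszul f k]. *)
Fixpoint seq_ideal (f : nat -> R) k (h : R) : Prop :=
  if k is l.+1 then exists g, seq_ideal f l (h - g * f l) else h = 0.

Lemma koszul_rank0 k : koszul_rank k 0 = 1%N.
Proof. by elim: k. Qed.

Lemma koszul_rank_gt k i : (k < i)%N -> koszul_rank k i = 0%N.
Proof.
elim: k i => [|k IH] [|i] //= lt_ki.
by rewrite !IH // ltnW.
Qed.

Lemma koszul_rank_top k : koszul_rank k k = 1%N.
Proof. by elim: k => //= k ->; rewrite koszul_rank_gt. Qed.

Lemma koszul_is_complex f k : is_complex (koszul f k).
Proof.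
elim: k => [|k IH] /=; first by move=> i; rewrite mul0mx.
by apply: cone_is_complex => // i; rewrite scalar_mxC.
Qed.

(** [koszul_rank k 0] equals 1 only propositionally, so the ring is identified
    with the module in degree 0 through constant vectors. *)
Lemma const_mx_koszul k (w : 'rV[R]_(koszul_rank k 0)) :
  exists h, w = const_mx h.
Proof.
move: w; rewrite koszul_rank0 => w; exists (w 0 0).
by apply/rowP=> i; rewrite mxE ord1.
Qed.

Lemma const_mx_augK k (h : R) :
  ((const_mx h : 'rV_(koszul_rank k 0)) *m
   (const_mx 1 : 'cV_(koszul_rank k 0))) 0 0 = h.
Proof. by rewrite koszul_rank0 mxE big_ord1 !mxE mulr1. Qed.

Lemma row_image_koszul0 f k h :
  row_image (koszul f k 0) (const_mx h) <-> seq_ideal f k h.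
Proof.
elim: k h => [|k IH] h.
  split=> [[u]|->]; last by exists 0; rewrite mul0mx.
  by rewrite mulmx0 => /rowP/(_ 0); rewrite !mxE.
split=> [/row_image_col_mx [a [b hE]]|[g /IH [a aE]]].
  have [g bE] := const_mx_koszul b; exists g; apply/IH; exists a.
  move: hE; rewrite bE mul_mx_scalar => hE.
  apply: (addIr (f k *: const_mx g)); rewrite -hE.
  by apply/rowP=> i; rewrite !mxE; ring.
apply/row_image_col_mx; exists a, (const_mx g); rewrite -aE.
by apply/rowP=> i; rewrite mul_mx_scalar !mxE; ring.
Qed.

(** The hypothesis is that the sequence is regular: it makes multiplication by
    [f l] injective on the degree 0 homology of [koszul f l]. *)
Lemma koszul_exact f k :
    (forall l h, (l < k)%N -> seq_ideal f l (h * f l) -> seq_ideal f l h) ->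
  exact (koszul f k).
Proof.
elim: k => [|k IH] reg /=.
  by move=> i w _; exists 0; rewrite mul0mx; apply/rowP=> -[].
have {}IH : exact (koszul f k) by apply: IH => l h ltl; apply/reg/ltnW.
apply: cone_exact => //; first by move=> i; rewrite scalar_mxC.
move=> b; have [h ->] := const_mx_koszul b.
rewrite mul_mx_scalar => fh; apply/row_image_koszul0/reg => //.
apply/row_image_koszul0; move: fh; congr row_image.
by apply/rowP=> i; rewrite !mxE mulrC.
Qed.

(** On the exterior basis this is the diagonal map [e_S |-> z_S e_S], where
    [z_S] is the product of the [z l] over [l] in [S]. *)
Fixpoint koszul_map (z : nat -> R) k :
    forall i, 'M[R]_(koszul_rank k i, koszul_rank k i) :=
  if k is l.+1 then fun i => match i with
    | 0 => koszul_map z l 0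
    | j.+1 => block_mx (koszul_map z l j.+1) 0 0 (z l *: koszul_map z l j)
    end
  else fun i => 1%:M.

Lemma koszul_map0 z k : koszul_map z k 0 = 1%:M.
Proof. by elim: k. Qed.

Lemma koszul_map_chain (f g z : nat -> R) k i :
    (forall l, f l = g l * z l) ->
  koszul f k i *m koszul_map z k i = koszul_map z k i.+1 *m koszul g k i.
Proof.
move=> fE; elim: k i => [|k IH] [|i] /=; rewrite ?mulmx0 ?mul0mx //.
  rewrite mul_col_mx mul_block_col !mul0mx add0r addr0 IH.
  by rewrite !mul_scalar_mx mul_mx_scalar scalerA fE.
rewrite !mulmx_block !mulmx0 !mul0mx !addr0 !add0r IH.
rewrite !mul_scalar_mx mul_mx_scalar scalerA fE.
by rewrite !mulNmx !mulmxN -scalemxAr -scalemxAl IH.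
Qed.

(** * A resolution of the quotient by J + xQ *)

Section Glue.
Variables (f y z : nat -> R) (x : R) (m : nat).

(** The truncations forget the degree 0 modules, which the comparison map
    identifies; what is left of the cone resolves the quotient of the ideal of
    [y] by the ideal of [f]. *)
Definition quot_rank : nat -> nat :=
  cone_rank (fun i => koszul_rank m i.+1) (fun i => koszul_rank m i.+1).

Definition quot_diff : forall i, 'M[R]_(quot_rank i.+1, quot_rank i) :=
  cone_diff (fun i => koszul y m i.+1) (fun i => koszul f m i.+1)
    (fun i => koszul_map z m i.+1).

(** The connecting projection of the cone onto [koszul f], multiplied by [x];
    in degree 0 it is induced by the inclusion of the ideal of [y] in the ring.
    The alternating sign compensates the sign of the cone differential. *)
Definition times_x i : 'M[R]_(quot_rank i, koszul_rank m i) :=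
  match i with
  | 0 => x *: koszul y m 0
  | j.+1 => col_mx 0 ((-1) ^+ j * x)%:M
  end.

Definition glue_rank := cone_rank (koszul_rank m) quot_rank.

Definition glue_diff : forall i, 'M[R]_(glue_rank i.+1, glue_rank i) :=
  cone_diff (koszul f m) quot_diff times_x.

Hypothesis fE : forall l, f l = y l * z l.

Lemma times_x_chain i :
  quot_diff i *m times_x i = times_x i.+1 *m koszul f m i.
Proof.
have chain i' := koszul_map_chain m i' fE.
case: i => [|i] /=.
  rewrite !mul_col_mx mul0mx expr0 mul1r mul_scalar_mx -!scalemxAr.
  by rewrite koszul_is_complex -chain koszul_map0 mulmx1 scaler0.
rewrite mul_block_col mul_col_mx !mulmx0 !mul0mx !add0r.
by rewrite mul_mx_scalar mul_scalar_mx exprS mulN1r mulNr scalerN scaleNr.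
Qed.

Lemma glue_is_complex : is_complex glue_diff.
Proof.
apply: cone_is_complex; first exact: times_x_chain.
  exact: koszul_is_complex.
apply: cone_is_complex => i; [|exact: koszul_is_complex..].
exact: koszul_map_chain.
Qed.

Hypothesis y_reg :
  forall l h, (l < m)%N -> seq_ideal y l (h * y l) -> seq_ideal y l h.
Hypothesis f_reg :
  forall l h, (l < m)%N -> seq_ideal f l (h * f l) -> seq_ideal f l h.
Hypothesis x_reg : forall h, seq_ideal f m (h * x) -> seq_ideal f m h.

(** Both injectivity conditions of [cone_exact] are read off in the ring: the
    degree 0 comparison is the identity, and [x] is regular modulo the ideal
    of [f]. *)
Lemma glue_exact : exact glue_diff.
Proof.
have chain i := koszul_map_chain m i fE.
have eA := koszul_exact f_reg; have eB := koszul_exact y_reg.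
apply: cone_exact => //; first exact: times_x_chain.
  apply: cone_exact => [i|i w|i w|b [u]] //; [exact: eB|exact: eA|move=> bE].
  apply: eA; have := chain 0%N; rewrite koszul_map0 mulmx1 => ->.
  by rewrite mulmxA bE -mulmxA koszul_is_complex mulmx0.
move=> /= b; have [h hE] := const_mx_koszul (b *m koszul y m 0).
rewrite -scalemxAr hE => xh.
have [a aE] : row_image (koszul f m 0) (const_mx h).
  apply/row_image_koszul0/x_reg/row_image_koszul0; move: xh; congr row_image.
  by apply/rowP=> i; rewrite !mxE mulrC.
have [c cE] : row_image (koszul y m 1) (b - a *m koszul_map z m 1).
  apply: eB; rewrite mulmxBl hE aE -mulmxA -chain koszul_map0 mulmx1.
  by rewrite subrr.
apply/row_image_col_mx; exists c, a; rewrite -cE; exact/esym/subrK.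
Qed.

Lemma row_image_glue0 h :
  row_image (glue_diff 0) (const_mx h) <->
  exists h1 h2, [/\ seq_ideal f m h1, seq_ideal y m h2 & h = h1 + h2 * x].
Proof.
split=> [/row_image_col_mx [a [b hE]]|[h1 [h2 [/row_image_koszul0 [a aE]]]]].
  have [h1 h1E] := const_mx_koszul (a *m koszul f m 0).
  have [h2 h2E] := const_mx_koszul (b *m koszul y m 0).
  exists h1, h2; split; [by apply/row_image_koszul0; exists a| |].
    by apply/row_image_koszul0; exists b.
  move: hE; rewrite /= -scalemxAr h1E h2E => hE.
  have i0 : 'I_(koszul_rank m 0) by rewrite koszul_rank0; exact: 0.
  by move/rowP/(_ i0): hE; rewrite !mxE mulrC.
move=> /row_image_koszul0 [b bE] ->; apply/row_image_col_mx; exists a, b.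
rewrite /= -scalemxAr -aE -bE.
by apply/rowP=> i; rewrite !mxE mulrC.
Qed.

End Glue.
End Complexes.

(** * Ideals of sequences and monomial ideals *)

Section Ideals.
Variable R : comNzRingType.

Lemma seq_ideal0 (f : nat -> R) k : seq_ideal f k 0.
Proof. by elim: k => //= k IH; exists 0; rewrite mul0r subr0. Qed.

Lemma seq_idealD (f : nat -> R) k g h :
  seq_ideal f k g -> seq_ideal f k h -> seq_ideal f k (g + h).
Proof.
elim: k g h => /= [g h -> ->|k IH g h [a ga] [b hb]]; first by rewrite addr0.
by exists (a + b); rewrite mulrDl opprD addrACA; exact: IH.
Qed.

Lemma seq_idealM (f : nat -> R) k c h :
  seq_ideal f k h -> seq_ideal f k (c * h).
Proof.
elim: k h => /= [h ->|k IH h [a ha]]; first by rewrite mulr0.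
by exists (c * a); rewrite -mulrA -mulrBr; exact: IH.
Qed.

Lemma seq_ideal_mem (f : nat -> R) k l : (l < k)%N -> seq_ideal f k (f l).
Proof.
elim: k => //= k IH; rewrite ltnS leq_eqVlt => /orP[/eqP->|/IH lk].
  by exists 1; rewrite mul1r subrr; exact: seq_ideal0.
by exists 0; rewrite mul0r subr0.
Qed.

Lemma seq_ideal_eq (f g : nat -> R) k h :
  f =1 g -> seq_ideal f k h <-> seq_ideal g k h.
Proof.
move=> fg; elim: k h => //= k IH h.
by split=> -[a /IH]; exists a; [rewrite -fg|rewrite fg].
Qed.

End Ideals.

Section MonomialIdeals.
Variables (K : fieldType) (N : nat).
Notation R := {mpoly K[N]}.

Definition supp_in (S : 'X_{1..N} -> Prop) (h : R) :=
  forall m, h@_m != 0 -> S m.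

(** Adding the monomial [u] to a monomial ideal: the subtracted multiple of
    [u] may be chosen to collect all the terms of [h] divisible by [u]. *)
Lemma supp_in_step S u h :
  (exists g, supp_in S (h - g * 'X_[u])) <->
  supp_in (fun m => S m \/ (u <= m)%MM) h.
Proof.
split=> [[g Sg] m hm|Sh].
  case: (boolP (u <= m)%MM) => um; [by right|left; apply: Sg].
  suff gm : (g * 'X_[u])@_m = 0 by rewrite mcoeffB gm subr0.
  apply/eqP; rewrite mcoeff_eq0 (perm_mem (msuppMX _ _)).
  by apply: contra um => /mapP[k _ ->]; exact: lem_addr.
exists (\sum_(k <- msupp h | (u <= k)%MM) h@_k *: 'X_[k - u]) => m.
rewrite mulr_suml {1}(mpolyE h) (bigID (fun k => (u <= k)%MM)) /=.
under [X in _ - X]eq_bigr => k uk do rewrite -scalerAl -mpolyXD submK //.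
rewrite addrC addrK; case: (boolP ((u <= m)%MM)) => um.
  rewrite raddf_sum big1 ?eqxx //= => k uk; rewrite mcoeffZ mcoeffX.
  by case: eqP uk => [->|_ _]; rewrite ?um // mulr0.
case: (eqVneq h@_m 0) => [hm|/Sh [] //]; last by rewrite (negPf um).
rewrite raddf_sum big1 ?eqxx //= => k uk; rewrite mcoeffZ mcoeffX.
by case: eqP => [->|_]; rewrite ?hm ?mul0r ?mulr0.
Qed.

Lemma seq_ideal_monomial (u : nat -> 'X_{1..N}) k h :
  seq_ideal (fun l => 'X_[u l]) k h <->
  supp_in (fun m => exists2 l, (l < k)%N & (u l <= m)%MM) h.
Proof.
elim: k h => [|k IH] h /=.
  split=> [-> m /eqP []|h0]; first by rewrite mcoeff0.
  by apply/mpolyP=> m; rewrite mcoeff0; apply/eqP/negPn/negP=> /h0 [].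
set S := fun m => exists2 l, (l < k)%N & (u l <= m)%MM.
apply: iff_trans (iff_trans (supp_in_step S (u k) h) _).
  by split=> -[g /IH hg]; exists g.
split=> Sh m /Sh.
  by case=> [[l lk ul]|uk]; [exists l => //; exact: ltnW|exists k].
case=> l; rewrite ltnS leq_eqVlt => /orP[/eqP->|lk] ul; first by right.
by left; exists l.
Qed.

(** A monomial coprime to the generators of a monomial ideal is regular
    modulo it: if a generator divides [v m], it divides [m]. *)
Lemma seq_ideal_regular (f : nat -> R) (u : nat -> 'X_{1..N}) k
    (v : 'X_{1..N}) (h : R) :
    (forall l, f l = 'X_[u l]) ->
    (forall l i, (l < k)%N -> u l i = 0%N \/ v i = 0%N) ->
  seq_ideal f k (h * 'X_[v]) -> seq_ideal f k h.
Proof.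
move=> fE disj; move/(seq_ideal_eq _ _ fE)/seq_ideal_monomial => hv.
apply/(seq_ideal_eq _ _ fE)/seq_ideal_monomial => m hm.
have [|l lk /mnm_lepP ul] := hv (v + m)%MM; first by rewrite mcoeffMX.
exists l => //; apply/mnm_lepP=> i; have := ul i; rewrite mnmDE.
by case: (disj l i lk) => ->.
Qed.

End MonomialIdeals.

Section IdealGen.
Variables (K : fieldType) (N : nat) (S : {mpoly K[N]} -> Prop).

Lemma ideal_gen_ideal : is_ideal (ideal_gen S).
Proof.
split.
- by exists 0%N, (fun=> 0), (fun=> 0); split=> [[]//|]; rewrite big_ord0.
- move=> _ _ [p [c [g [Sg ->]]]] [q [d [h [Sh ->]]]].
  pose glue (a : 'I_p -> {mpoly K[N]}) b (i : 'I_(p + q)) :=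
    match split i with inl j => a j | inr j => b j end.
  exists (p + q)%N, (glue c d), (glue g h); split.
    by move=> i; rewrite /glue; case: split.
  rewrite big_split_ord /glue /=; congr (_ + _); apply: eq_bigr => i _.
    by rewrite (unsplitK (inl i)).
  by rewrite (unsplitK (inr i)).
- move=> f _ [p [c [g [Sg ->]]]]; exists p, (fun i => f * c i), g; split=> //.
  by rewrite mulr_sumr; apply: eq_bigr => i _; rewrite mulrA.
Qed.

Lemma ideal_gen_mem f : S f -> ideal_gen S f.
Proof.
by move=> Sf; exists 1%N, (fun=> 1), (fun=> f); rewrite big_ord1 mul1r.
Qed.

Lemma ideal_gen_sub (J : {mpoly K[N]} -> Prop) f :
  is_ideal J -> (forall g, S g -> J g) -> ideal_gen S f -> J f.
Proof.
move=> [J0 JD JM] SJ [p [c [g [Sg ->]]]].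
by apply: big_ind => // i _; apply/JM/SJ.
Qed.

Lemma seq_ideal_ideal (f : nat -> {mpoly K[N]}) k : is_ideal (seq_ideal f k).
Proof.
split; [exact: seq_ideal0|exact: seq_idealD|exact: seq_idealM].
Qed.

Lemma seq_ideal_sub (J : {mpoly K[N]} -> Prop) f k h :
    is_ideal J -> (forall l, (l < k)%N -> J (f l)) -> seq_ideal f k h -> J h.
Proof.
move=> [J0 JD JM]; elim: k h => [h _ -> //|k IH] h fJ [a ha].
rewrite -(subrK (a * f k) h); apply: JD; last exact/JM/fJ.
by apply: IH ha => l lk; exact/fJ/ltnW.
Qed.

Lemma colon_ideal (J : {mpoly K[N]} -> Prop) f :
  is_ideal J -> is_ideal (colon J f).
Proof.
move=> [J0 JD JM]; split=> [|g h|g h]; rewrite /colon ?mul0r //.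
  by rewrite mulrDl; exact: JD.
by rewrite -mulrA; exact: JM.
Qed.

(** The substitution that kills the given variables is an endomorphism of a
    domain, and it is the identity modulo the ideal they generate, so this
    ideal is its kernel. *)
Lemma prime_seq_ideal_var (i : nat -> 'I_N) k :
  prime_ideal (seq_ideal (fun l => 'X_(i l) : {mpoly K[N]}) k).
Proof.
set Q := seq_ideal _ k; have [Q0 QD QM] : is_ideal Q by exact: seq_ideal_ideal.
pose v j : {mpoly K[N]} := if [exists l : 'I_k, i l == j] then 0 else 'X_j.
pose phi := mmap (@mpolyC N K) v.
have phi0 : phi 0 = 0 by exact: rmorph0.
have phi1 : phi 1 = 1 by exact: rmorph1.
have phiD a b : phi (a + b) = phi a + phi b by exact: rmorphD.
have phiM a b : phi (a * b) = phi a * phi b by exact: rmorphM.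
have phiX j : phi 'X_j = v j by rewrite /phi mmapX mmap1U.
have phiC c : phi c%:MP = c%:MP by exact: mmapC.
have phiQ h : Q h -> phi h = 0.
  apply: (seq_ideal_sub (J := fun h => phi h = 0)) => [|l lk].
    split=> [|a b|a b] //; first by rewrite phiD => -> ->; rewrite addr0.
    by rewrite phiM => ->; rewrite mulr0.
  rewrite phiX /v; case: existsP => // -[].
  by exists (Ordinal lk).
have QB a b : Q (a - phi a) -> Q (b - phi b) -> Q (a * b - phi (a * b)).
  move=> Qa Qb; rewrite phiM.
  have -> : a * b - phi a * phi b = b * (a - phi a) + phi a * (b - phi b).
    by ring.
  by apply: QD; exact: QM.
have Qphi h : Q (h - phi h).
  elim/mpolyind: h => [|c m p _ _ Qp]; first by rewrite phi0 subr0.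
  rewrite phiD opprD addrACA; apply: (QD _ _ _ Qp).
  rewrite -mul_mpolyC; apply: (QB c%:MP); first by rewrite phiC subrr.
  rewrite mpolyXE_id.
  apply: (big_ind (fun a => Q (a - phi a))); last move=> j _.
  - by rewrite phi1 subrr.
  - exact: QB.
  elim: (m j) => [|e IH]; first by rewrite expr0 phi1 subrr.
  rewrite exprS; apply: (QB _ _ _ IH); rewrite phiX /v.
  case: existsP => [[l /eqP <-]|_]; last by rewrite subrr.
  by rewrite subr0; exact: (seq_ideal_mem (fun l => 'X_(i l))).
split=> //; first by move/phiQ/eqP; rewrite phi1 oner_eq0.
move=> f g /phiQ /eqP; rewrite phiM mulf_eq0.
case/orP=> /eqP f0; [left|right].
  by have := Qphi f; rewrite f0 subr0.
by have := Qphi g; rewrite f0 subr0.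
Qed.

End IdealGen.

(** * Grading and regularity *)

Section Grading.
Variables (K : fieldType) (N : nat).
Notation R := {mpoly K[N]}.

(** Asking for a positive degree wherever the entry is nonzero covers at once
    the homogeneity and the minimality of a differential. *)
Definition graded p q (s : 'I_p -> int) (t : 'I_q -> int) (M : 'M[R]_(p, q)) :=
  forall k l, M k l = 0 \/
    exists d, s k - t l = d.+1%:Z /\ M k l \is d.+1.-homog.

Definition cone_shift (rF rG : nat -> nat)
    (sF : forall i, 'I_(rF i) -> int) (sG : forall i, 'I_(rG i) -> int) i :
    'I_(cone_rank rF rG i) -> int :=
  match i with
  | 0 => sF 0%N
  | j.+1 => fun k => match split k with inl a => sF j.+1 a | inr b => sG j b end
  end.

Lemma cone_graded (rF rG : nat -> nat) sF sG
    (dF : forall i, 'M[R]_(rF i.+1, rF i))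
    (dG : forall i, 'M[R]_(rG i.+1, rG i)) phi :
    (forall i, graded (sF i.+1) (sF i) (dF i)) ->
    (forall i, graded (sG i.+1) (sG i) (dG i)) ->
    (forall i, graded (sG i) (sF i) (phi i)) ->
  forall i, graded (cone_shift sF sG (i := i.+1)) (cone_shift sF sG (i := i))
    (cone_diff dF dG phi i).
Proof.
move=> gF gG gphi [|i] k l /=; rewrite !mxE.
  by case: split => a; [exact: gF|exact: gphi].
case: split => a; rewrite mxE; case: split => b.
- exact: gF.
- by rewrite mxE; left.
- exact: gphi.
rewrite mxE; have [->|[d [dE dM]]] := gG i a b; first by left; rewrite oppr0.
by right; exists d; rewrite rpredN.
Qed.

Lemma graded_const p q (a b : int) d (M : 'M[R]_(p, q)) :
    a - b = d.+1%:Z -> (forall k l, M k l \is d.+1.-homog) ->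
  graded (fun=> a) (fun=> b) M.
Proof. by move=> abE gM k l; right; exists d. Qed.

Lemma homog_scalar_mx p d (a : R) (k l : 'I_p) :
  a \is d.-homog -> (a%:M : 'M_p) k l \is d.-homog.
Proof. by move=> ha; rewrite mxE; case: eqP => _ //; rewrite rpred0. Qed.

Lemma koszul_homog e (f : nat -> R) k i a b :
  (forall l, f l \is e.-homog) -> koszul f k i a b \is e.-homog.
Proof.
move=> fe; elim: k i a b => [|k IH] [|i] a b /=; rewrite ?mxE ?rpred0 //.
  by case: split => c //; exact: homog_scalar_mx.
case: split => c; rewrite mxE; case: split => c' //.
- by rewrite mxE rpred0.
- exact: homog_scalar_mx.
by rewrite mxE rpredN.
Qed.

Lemma koszul_map_homog (z : nat -> R) k i a b :
  (forall l, z l \is 1.-homog) -> koszul_map z k i a b \is i.-homog.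
Proof.
move=> z1; elim: k i a b => [|k IH] [|i] a b /=.
- by rewrite homog_scalar_mx ?dhomog1.
- by case: a.
- exact: IH.
rewrite mxE.
case: split => c; rewrite mxE; case: split => c' //; rewrite ?mxE ?rpred0 //.
exact: dhomogM (z1 k) (IH _ _ _).
Qed.

Variables (y z : nat -> R) (x : R) (m : nat).
Hypothesis y1 : forall l, y l \is 1.-homog.
Hypothesis z1 : forall l, z l \is 1.-homog.
Hypothesis x1 : x \is 1.-homog.

Let f l := y l * z l.

(** The two summands of the inner cone are made of the modules of index
    [i + 1] of the two Koszul complexes, of degrees [i + 1] and [2 (i + 1)],
    and multiplication by [x] raises these by one. *)
Definition glue_shift : forall i, 'I_(glue_rank m i) -> int :=
  cone_shift (fun i _ => (i.*2)%:Z)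
    (cone_shift (fun i (_ : 'I_(koszul_rank m i.+1)) => i.+2%:Z)
                (fun i (_ : 'I_(koszul_rank m i.+1)) => (i.*2.+3)%:Z)).

Lemma leg_homog l : f l \is 2.-homog.
Proof. exact: (dhomogM (y1 l) (z1 l)). Qed.

Lemma glue_graded i :
  graded (glue_shift (i := i.+1)) (glue_shift (i := i)) (glue_diff f y z x m i).
Proof.
apply: cone_graded => {}i.
- apply: (@graded_const _ _ _ _ 1); first lia.
  by move=> k l; apply: koszul_homog leg_homog.
- apply: cone_graded => {}i.
  + apply: (@graded_const _ _ _ _ 0); first lia.
    by move=> k l; apply: koszul_homog.
  + apply: (@graded_const _ _ _ _ 1); first lia.
    by move=> k l; apply: koszul_homog leg_homog.
  apply: (@graded_const _ _ _ _ i); first lia.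
  by move=> k l; apply: koszul_map_homog.
case: i => [|i] /=.
  apply: (@graded_const _ _ _ _ 1); first lia.
  move=> k l; rewrite mxE -[2%N]/(1 + 1)%N.
  by apply: dhomogM => //; exact: koszul_homog.
move=> k l; rewrite mxE; case: split => c; first by rewrite mxE; left.
right; exists 0%N; split; first lia.
apply: homog_scalar_mx; rewrite -signr_odd.
by case: odd; rewrite ?expr1 ?expr0 ?mulN1r ?mul1r ?rpredN.
Qed.

Lemma shift_bound i (k : 'I_(glue_rank m i)) :
  (0 < m)%N -> (glue_shift k - i%:Z <= m%:Z)%R.
Proof.
move=> m0.
have leq_of j : 'I_(koszul_rank m j) -> (j <= m)%N.
  by case: (leqP j m) => // /koszul_rank_gt -> [].
case: i k => [|i] k /=; first lia.
case: split => a; first by have := leq_of _ a; lia.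
case: i k a => [|i] k a /=; first lia.
by case: split => b; [|have := leq_of _ b]; lia.
Qed.

Variable I : R -> Prop.
Hypothesis y_reg :
  forall l h, (l < m)%N -> seq_ideal y l (h * y l) -> seq_ideal y l h.
Hypothesis f_reg :
  forall l h, (l < m)%N -> seq_ideal f l (h * f l) -> seq_ideal f l h.
Hypothesis x_reg : forall h, seq_ideal f m (h * x) -> seq_ideal f m h.
Hypothesis IE : forall h, I h <->
  exists h1 h2, [/\ seq_ideal f m h1, seq_ideal y m h2 & h = h1 + h2 * x].

Lemma glue_resolution : exists F : min_resolution I,
  forall i j, betti F i j = #|[set k : 'I_(glue_rank m i) | glue_shift k == j]|.
Proof.
have fE l : f l = y l * z l by [].
have g := glue_graded.
pose one : 'cV[R]_(glue_rank m 0) := const_mx 1.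
have aug_hom k : in_degree (@glue_shift 0 k) (one k 0).
  by rewrite mxE; exact: dhomog1.
have diff_hom i k l :
    in_degree (@glue_shift i.+1 k - glue_shift l) (glue_diff f y z x m i k l).
  have [->|[d [-> hd]]] // := g i k l.
  by case: (_ - _) => // e; exact: dhomog0.
have augK (h : R) :
    ((const_mx h : 'rV_(glue_rank m 0)) *m one) 0 0
    = h := const_mx_augK m h.
have aug_sur h : exists w : 'rV_(glue_rank m 0), I (h - (w *m one) 0 0).
  exists (const_mx h : 'rV_(glue_rank m 0)); rewrite augK subrr.
  apply/IE/(row_image_glue0 f y z); exists 0; rewrite mul0mx; exact/rowP.
have ex0 (w : 'rV_(glue_rank m 0)) :
    I ((w *m one) 0 0) <-> exists u, w = u *m glue_diff f y z x m 0.
  have [h ->] : exists h, w = const_mx h := const_mx_koszul w.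
  rewrite augK.
  exact: iff_trans (IE h) (iff_sym (row_image_glue0 f y z x m h)).
have exS i (w : 'rV_(glue_rank m i.+1)) : w *m glue_diff f y z x m i = 0 <->
    exists u, w = u *m glue_diff f y z x m i.+1.
  split; first exact: (glue_exact fE y_reg f_reg x_reg).
  by move=> [u ->]; rewrite -mulmxA glue_is_complex // mulmx0.
have minF i k l : (glue_diff f y z x m i k l)@_0%MM = 0.
  have [->|[d [_ hd]]] // := g i k l; first exact: mcoeff0.
  by apply: (dhomog_nemf_coeff hd); rewrite mf0.
by exists (MinResolution aug_hom diff_hom aug_sur ex0 exS minF).
Qed.

Lemma glue_regularity : (0 < m)%N -> is_regularity I m%:Z.
Proof.
move=> m_gt0; have [F bettiE] := glue_resolution; exists F; split.
  have mE : m.-1.+1 = m by rewrite prednK.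
  exists m.-1.+1, (m.-1.+1.*2)%:Z; split; last lia.
  rewrite bettiE; apply/eqP; rewrite -lt0n; apply/card_gt0P.
  have k : 'I_(koszul_rank m m.-1.+1) by rewrite mE koszul_rank_top; exact: 0.
  by exists (lshift _ k); rewrite inE /glue_shift /= (unsplitK (inl k)).
move=> i j; rewrite bettiE => /eqP; rewrite -lt0n => /card_gt0P [k].
by rewrite inE => /eqP <-; exact: shift_bound.
Qed.

End Grading.

(** * The spider *)

Section Spider.
Variable n : nat.
Notation leg := ('I_n.+1).
Notation T := (option (leg * bool)).

(** [None] is the center, [Some (i, false)] the [i]-th joint and
    [Some (i, true)] the [i]-th foot. *)
Definition spider_adj (a b : T) : bool :=
  match a, b with
  | None, Some (_, s) | Some (_, s), None => ~~ s
  | Some (i, s), Some (j, t) => (i == j) && (s != t)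
  | None, None => false
  end.

Lemma spider_adj_sym : ssrbool.symmetric spider_adj.
Proof. by move=> [[i s]|] [[j t]|] //=; rewrite eq_sym [s == t]eq_sym. Qed.

Lemma spider_adj_irr : irreflexive spider_adj.
Proof. by move=> [[i s]|] //=; rewrite !eqxx. Qed.

Definition spider : sgraph := SGraph spider_adj_sym spider_adj_irr.

Lemma spider_connected : connected_graph spider.
Proof.
split; first by apply/card_gt0P; exists None.
have sym : connect_sym (@adj spider).
  by apply: sym_connect_sym; exact: spider_adj_sym.
have center (a : spider) : connect (@adj spider) None a.
  case: a => [[i []]|]; last exact: connect0.
    apply: (@connect_trans _ _ (Some (i, false))); apply: connect1 => //=.
    by rewrite eqxx.
  exact: connect1.
by move=> a b; apply: connect_trans (center b); rewrite sym.
Qed.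

Variable K : fieldType.
Notation R := {mpoly K[#|spider|]}.
Notation I := (edge_ideal K spider).

Definition joint l : 'I_#|spider| := enum_rank (Some (inord l, false) : spider).
Definition foot l : 'I_#|spider| := enum_rank (Some (inord l, true) : spider).
Definition center : 'I_#|spider| := enum_rank (None : spider).

Notation y := (fun l => 'X_(joint l) : R).
Notation z := (fun l => 'X_(foot l) : R).
Notation x := ('X_center : R).
Notation f := (fun l => y l * z l).
Notation J := (seq_ideal f n.+1).
Notation Q := (seq_ideal y n.+1).

Lemma joint_inj j l :
  (j < n.+1)%N -> (l < n.+1)%N -> joint j = joint l -> j = l.
Proof.
move=> jn ln /enum_rank_inj/(@Some_inj _)/(congr1 (fun a => val a.1)) /=.
by rewrite !inordK.
Qed.

(** The edges between joints and feet generate [J], those at the center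
    generate [x Q]. *)
Lemma edge_idealE h :
  I h <-> exists h1 h2, [/\ J h1, Q h2 & h = h1 + h2 * x].
Proof.
have [J0 JD JM] : is_ideal J by exact: seq_ideal_ideal.
have [Q0 QD QM] : is_ideal Q by exact: seq_ideal_ideal.
have II : is_ideal I by exact: ideal_gen_ideal.
have [I0 ID IM] := II; split; last first.
  move=> [h1 [h2 [Jh1 Qh2 ->]]]; apply: ID.
    apply: seq_ideal_sub Jh1 => // l _; apply: ideal_gen_mem.
    by exists (Some (inord l, false)), (Some (inord l, true)); rewrite /= eqxx.
  apply: (seq_ideal_sub (J := colon I x)) Qh2 => [|l _].
    exact: colon_ideal.
  by apply: ideal_gen_mem; exists (Some (inord l, false)), None.
pose L h := exists h1 h2, [/\ J h1, Q h2 & h = h1 + h2 * x].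
apply: (ideal_gen_sub (J := L)).
  split=> [|_ _ [a1 [a2 [Ja Qa ->]]] [b1 [b2 [Jb Qb ->]]]
           |c _ [a1 [a2 [Ja Qa ->]]]].
  - by exists 0, 0; split=> //; rewrite mul0r addr0.
  - exists (a1 + b1), (a2 + b2); split; [exact: JD|exact: QD|].
    by rewrite mulrDl addrACA.
  - exists (c * a1), (c * a2); split; [exact: JM|exact: QM|].
    by rewrite mulrDr mulrA.
have footE (i : leg) : 'X_(foot i) = var K (Some (i, true) : spider).
  by rewrite /foot inord_val.
have jointE (i : leg) : 'X_(joint i) = var K (Some (i, false) : spider).
  by rewrite /joint inord_val.
have Jedge (i : leg) : J ('X_(joint i) * 'X_(foot i)).
  exact: (seq_ideal_mem f (ltn_ord i)).
have Qjoint (i : leg) : Q 'X_(joint i) by exact: (seq_ideal_mem y (ltn_ord i)).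
move=> g [[[i s]|] [[[j t]|] []]] //=.
- case/andP=> /eqP <-; case: s; case: t => // _ ->.
    rewrite -footE -jointE mulrC; exists ('X_(joint i) * 'X_(foot i)), 0.
    by split=> //; rewrite mul0r addr0.
  rewrite -footE -jointE; exists ('X_(joint i) * 'X_(foot i)), 0.
  by split=> //; rewrite mul0r addr0.
- case: s => // _ ->; exists 0, 'X_(joint i); rewrite jointE.
  by split=> //; [rewrite -jointE|rewrite add0r].
- case: t => // _ ->; exists 0, 'X_(joint j); rewrite jointE.
  by split=> //; [rewrite -jointE|rewrite add0r mulrC].
Qed.

Lemma monomial_f l :
  'X_(joint l) * 'X_(foot l) = 'X_[U_(joint l) + U_(foot l)] :> R.
Proof. by rewrite mpolyXD. Qed.

Lemma center_regular h : J (h * x) -> J h.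
Proof.
apply: (seq_ideal_regular monomial_f) => l i _; rewrite mnmDE !mnm1E.
case: (eqVneq center i) => [<-|]; [left|by right].
by rewrite !(inj_eq enum_rank_inj).
Qed.

Lemma joint_regular l h :
  (l < n.+1)%N -> seq_ideal y l (h * y l) -> seq_ideal y l h.
Proof.
move=> ln.
apply: (@seq_ideal_regular _ _ _ (fun j => U_(joint j)%MM)) => // j i jl.
rewrite !mnm1E; case: (eqVneq (joint l) i) => [<-|]; [left|by right].
have jn : (j < n.+1)%N by exact: ltn_trans ln.
by case: eqP => // /(joint_inj jn ln) jlE; rewrite jlE ltnn in jl.
Qed.

Lemma leg_regular l h :
  (l < n.+1)%N -> seq_ideal f l (h * f l) -> seq_ideal f l h.
Proof.
move=> ln; rewrite /= monomial_f.
apply: (seq_ideal_regular monomial_f) => j i jl.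
have jn : (j < n.+1)%N by exact: ltn_trans ln.
have jl_inord : (inord j == inord l :> leg) = false.
  apply/eqP=> /(congr1 val); rewrite /= !inordK // => jlE.
  by rewrite jlE ltnn in jl.
rewrite !mnmDE !mnm1E.
case: (eqVneq (joint l) i) => [<-|_].
  left; rewrite !(inj_eq enum_rank_inj) !(inj_eq (@Some_inj _)).
  by rewrite !xpair_eqE jl_inord.
case: (eqVneq (foot l) i) => [<-|_]; last by right.
left; rewrite !(inj_eq enum_rank_inj) !(inj_eq (@Some_inj _)).
by rewrite !xpair_eqE jl_inord.
Qed.

Lemma spider_regularity : is_regularity I n.+1%:Z.
Proof.
apply: (@glue_regularity _ _ y z x n.+1) => //.
- by move=> l; rewrite dhomogX /= mdeg1.
- by move=> l; rewrite dhomogX /= mdeg1.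
- by rewrite dhomogX /= mdeg1.
- exact: joint_regular.
- exact: leg_regular.
- exact: center_regular.
exact: edge_idealE.
Qed.

(** If [h x = h1 + h2 x] with [h1] in [J], then [x] being regular modulo [J]
    puts [h - h2] in [J], which is contained in [Q]. *)
Lemma colon_center h : colon I x h <-> Q h.
Proof.
have [J0 JD JM] : is_ideal J by exact: seq_ideal_ideal.
have [Q0 QD QM] : is_ideal Q by exact: seq_ideal_ideal.
rewrite /colon edge_idealE; split=> [[h1 [h2 [Jh1 Qh2 hx]]]|Qh]; last first.
  by exists 0, h; rewrite add0r.
rewrite -(subrK h2 h); apply: QD => //.
have : J (h - h2) by apply: center_regular; rewrite mulrBl hx addrK.
apply: seq_ideal_sub => [|l ln]; first exact: seq_ideal_ideal.
rewrite mulrC; apply: QM.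
exact: (seq_ideal_mem y ln).
Qed.

Lemma center_notin : ~ I x.
Proof.
have [_ Q1 _] := prime_seq_ideal_var K joint n.+1.
by move=> Ix; apply/Q1/colon_center; rewrite /colon mul1r.
Qed.

(** Setting the joint 0 to 1 and every other variable to 0 kills all edges. *)
Lemma joint_notin : ~ I (y 0%N).
Proof.
pose v i : K := (i == joint 0)%:R.
have vJ h : J h -> h.@[v] = 0.
  apply: (seq_ideal_sub (J := fun h => h.@[v] = 0)) => [|l _].
    split=> [|a b|a b]; rewrite ?rmorph0 // ?rmorphD ?rmorphM /=.
      by move=> -> ->; rewrite addr0.
    by move=> ->; rewrite mulr0.
  rewrite rmorphM /= !mevalXU /v !(inj_eq enum_rank_inj).
  by rewrite !(inj_eq (@Some_inj _)) !xpair_eqE andbF mulr0.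
move=> /edge_idealE [h1 [h2 [/vJ h1v _ /(congr1 (meval v))]]].
rewrite rmorphD rmorphM /= h1v !mevalXU /v eqxx !(inj_eq enum_rank_inj) /=.
by rewrite mulr0 addr0 => /eqP; rewrite oner_eq0.
Qed.

Lemma spider_v_number : is_v_number I 1.
Proof.
split.
  exists x, Q; split; [by rewrite dhomogX /= mdeg1| |exact: colon_center].
  split; first exact: prime_seq_ideal_var.
  by exists x => h; apply: iff_sym; exact: colon_center.
case=> // -[g [P [g0 [[_ P1 Pprime] _] gP]]]; exfalso.
have gE : g = (g@_0%MM)%:MP.
  apply/mpolyP=> m; rewrite mcoeffC.
  case: (eqVneq m 0%MM) => [->|m0]; first by rewrite mulr1.
  by rewrite mulr0; apply: (dhomog_nemf_coeff g0); rewrite mdeg_eq0.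
have [I0 _ IM] : is_ideal I by exact: ideal_gen_ideal.
case: (eqVneq g@_0%MM 0) => gn0.
  by apply: P1; apply/gP; rewrite /colon gE gn0 mulr0.
have IP h : I h <-> P h.
  apply: iff_trans (gP h); rewrite /colon gE mulrC.
  split=> [|Ih]; first exact: IM.
  have := IM (g@_0%MM)^-1%:MP _ Ih.
  by rewrite mulrA -mpolyCM mulVf // mul1r.
have Pyx : P (y 0%N * x) by apply/IP/colon_center; exact: (seq_ideal_mem y).
by case: (Pprime _ _ Pyx) => /IP; [exact: joint_notin|exact: center_notin].
Qed.

End Spider.

Theorem corollary4p15 (K : fieldType) (n : nat) (hn : (0 < n)%N) :
  exists G : sgraph,
    connected_graph G /\
    exists (r : int) (v : nat),
      [/\ is_regularity (edge_ideal K G) r,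
          is_v_number (edge_ideal K G) v
        & r - v%:Z = n%:Z].
Proof.
exists (spider n); split; first exact: spider_connected.
exists n.+1%:Z, 1%N; split; last lia.
- exact: spider_regularity.
- exact: spider_v_number.
Qed.
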